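(* Let $G$ be a finite group, let $N$ be a normal subgroup of $G$, and let $p$ be a prime. Then all elements of $G \setminus N$ have $p$-power order if and only if either (1) $G$ is a $p$-group, or (2) there is a Sylow $p$-subgroup $P$ of $G$ such that $G = NP$ and $(G, P, P \cap N)$ is a Frobenius-Wielandt triple.
   Context: All groups are finite. For a subgroup $H$ of a group $G$ and $g \in G$, $H^g = g^{-1}Hg$. Given a group $G$, a subgroup $H \le G$ and a subgroup $L \le H$, the triple $(G,H,L)$ is called a Frobenius-Wielandt triple if $L$ is normal in $H$ and $H \cap H^g \le L$ for all $g \in G \setminus H$. *)

(* Defs.v *)
From mathcomp Require Import all_boot all_fingroup all_solvable.

Set Implicit Arguments.
Unset Strict Implicit.
Unset Printing Implicit Defensive.

Import GroupScope.

Definition frobenius_wielandt_triple (gT : finGroupType) (G H L : {group gT}) : Prop :=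
  [/\ H \subset G, L <| H
    & forall g : gT, g \in G :\: H -> H :&: H :^ g \subset L].

(* Main.v *)
Require Import Defs.
From mathcomp Require Import all_boot all_fingroup all_solvable.

Set Implicit Arguments.
Unset Strict Implicit.
Unset Printing Implicit Defensive.

Import GroupScope.

(** The converse is a count.  Let [G = N P], with [P :&: P :^ g] contained in [N]
    for all [g] in [G :\: P].  If [P] lies in [N], then [G = N] and there is
    nothing to prove.  Otherwise [P :\: N] has [|G : P|] conjugates in [G], which
    are pairwise disjoint.  Together they have
    [|G : P| (|P| - |P :&: N|) = |G| - |N|] elements: they fill [G :\: N], so
    every element outside [N] is conjugate to an element of [P].

    For the direct implication, suppose that all elements outside [N] are
    p-elements.  Then p'-elements lie in [N], and a nontrivial one commutes with
    no element outside [N] ([p'elt_cent_outside]).  Hence a p-subgroup [D] not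
    contained in [N] has a p-group as normaliser: a p'-element [k] normalising
    [D] lies in [N], so it acts trivially on [D / N], and by coprime action
    ['C_D[k]] covers this nontrivial quotient; so [k] commutes with an element
    outside [N], and [k = 1] ([normaliser_outside_pgroup]).  Since
    normalisers grow in p-groups, it follows that such a [D] lies in only one
    Sylow p-subgroup ([Sylow_meet_outside]).  If [g] is in [G :\: P] and
    [P :&: P :^ g] is not contained in [N], then [P :^ g = P], so [g] lies in
    the p-group ['N_G(P)], which is [P] by maximality: a contradiction. *)

Lemma pgroup_elt (gT : finGroupType) (pi : nat_pred) (G : {group gT}) :
  {in G, forall x, pi.-elt x} -> pi.-group G.
Proof.
move=> piG; apply/pgroupP=> q q_pr /(Cauchy q_pr)[x Gx ox].
by have := piG x Gx; rewrite /p_elt ox pnatE.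
Qed.

Section OutsidePElements.

Variables (gT : finGroupType) (G N : {group gT}) (p : nat).
Hypotheses (nsNG : N <| G) (pGN : forall x, x \in G :\: N -> p.-elt x).

Lemma p'elt_inside k : k \in G -> p^'.-elt k -> k \in N.
Proof.
move=> Gk p'k; apply/negPn/negP=> N'k.
have pk : p.-elt k by apply: pGN; rewrite inE N'k.
by case/negP: N'k; rewrite (eqP (_ : k == 1)) // -order_eq1 (pnat_1 pk p'k).
Qed.

(** As [k] lies in [N], the product [x * k] is again outside [N].  So [x] and
    [x * k] are commuting p-elements, and [k = x^-1 * (x * k)] is both a
    p-element and a p'-element. *)
Lemma p'elt_cent_outside x k :
  x \in G :\: N -> k \in G -> p^'.-elt k -> commute x k -> k = 1.
Proof.
move=> GN'x Gk p'k cxk; have Nk := p'elt_inside Gk p'k.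
have [Gx N'x] : x \in G /\ x \notin N by case/setDP: GN'x.
have GN'xk : x * k \in G :\: N by rewrite inE groupMr // N'x groupM.
have pk : p.-elt k.
  have ->: k = x^-1 * (x * k) by rewrite mulKg.
  apply: p_eltM; [ | by rewrite p_eltV pGN | exact: pGN].
  by apply: commuteM; [apply/commute_sym/commuteV | apply/commute_sym/commuteV].
by apply/eqP; rewrite -order_eq1 (pnat_1 pk p'k).
Qed.

(** Coprime action is used in the form that ['C_D(<[k]>)] maps onto the
    centraliser of [<[k]>] in [D / N].  Here [k] need not have order prime to
    that of [N]; it is enough that [N :&: [~: D, <[k]>]] lies in [D]. *)
Lemma normaliser_outside_pgroup (D : {group gT}) :
  D \subset G -> p.-group D -> ~~ (D \subset N) -> p.-group 'N_G(D).
Proof.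
move=> sDG pD N'D; apply: pgroup_elt => y /setIP[Gy nDy].
set k := y.`_p^'.
have p'k : p^'.-elt k by apply: p_elt_constt.
have Gk : k \in G by rewrite groupX.
have nDk : <[k]> \subset 'N(D) by rewrite cycle_subG groupX.
suff k1 : k = 1 by rewrite -(consttC p y) -/k k1 mulg1 p_elt_constt.
have Nk := p'elt_inside Gk p'k.
have sAN : <[k]> \subset N by rewrite cycle_subG.
have sRD : N :&: [~: D, <[k]>] \subset D.
  by rewrite subIset // commg_subl nDk orbT.
have coR : coprime #|N :&: [~: D, <[k]>]| #|<[k]>|.
  exact: pnat_coprime (pgroupS sRD pD) p'k.
(* The cycle of [k] is trivial modulo [N], so it centralises all of [D / N]. *)
have defDN : 'C_D(<[k]>) / N = D / N.
  have solR := solvableS sRD (pgroup_sol pD).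
  have nNA := subset_trans sAN (normG N).
  rewrite (strongest_coprime_quotient_cent nNA sRD coR) ?solR //.
  by rewrite (quotientS1 sAN) (setIidPl _) ?cents1.
have [x Dx N'x] : exists2 x, x \in 'C_D(<[k]>) & x \notin N.
  apply/subsetPn; apply: contra N'D => sCN.
  have nND := subset_trans sDG (normal_norm nsNG).
  by rewrite -quotient_sub1 // -defDN (quotientS1 sCN).
have [{}Dx cxk] := setIP Dx.
apply: (@p'elt_cent_outside x) => //; first by rewrite inE N'x (subsetP sDG).
exact: centP cxk k (cycle_id k).
Qed.

(** Descending induction on the order of the intersection [D]: if [D] is proper in [P] and
    [Q], then a Sylow p-subgroup containing the p-group ['N_G(D)] meets both of
    them in more than [D], hence equals both. *)
Lemma Sylow_meet_outside (P Q : {group gT}) :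
    p.-Sylow(G) P -> p.-Sylow(G) Q -> ~~ (P :&: Q \subset N) ->
  P :=: Q.
Proof.
have [m] := ubnP (#|G| - #|P :&: Q|).
elim: m P Q => // m IHm P Q lem sylP sylQ N'D.
have [sPG pP _] := and3P sylP; have [sQG pQ _] := and3P sylQ.
have eqPQ : #|P| = #|Q| by rewrite (card_Hall sylP) (card_Hall sylQ).
have [sPQ | nsPQ] := boolP (P \subset Q).
  by apply/eqP; rewrite eqEcard sPQ eqPQ /=.
have nsQP : ~~ (Q \subset P).
  apply: contra nsPQ => sQP.
  by rewrite (_ : P :=: Q) //; apply/esym/eqP; rewrite eqEcard sQP eqPQ /=.
set D := (P :&: Q)%G in lem N'D.
have sDP : D \subset P by apply: subsetIl.
have sDQ : D \subset Q by apply: subsetIr.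
have sDG : D \subset G by apply: subset_trans sPG.
have pN := normaliser_outside_pgroup sDG (pgroupS sDP pP) N'D.
have [R sylR sNR] := Sylow_superset (subsetIl G 'N(D)) pN.
have meetR (S : {group gT}) :
  p.-Sylow(G) S -> p.-group S -> D \proper S -> S :=: R.
  move=> sylS pS ltDS.
  have ltD : D \proper S :&: R.
    apply: proper_sub_trans (nilpotent_proper_norm (pgroup_nil pS) ltDS) _.
    rewrite subsetI subsetIl (subset_trans _ sNR) //.
    by rewrite setSI // (pHall_sub sylS).
  apply: IHm => //; last first.
    by apply: contra N'D; apply: subset_trans; apply: proper_sub.
  have := proper_card ltD.
  have : #|S :&: R| <= #|G|.
    by rewrite subset_leq_card // subIset // (pHall_sub sylS).
  move=> leG ltc; rewrite -ltnS; apply: leq_trans lem.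
  by rewrite ltnS ltn_sub2l // (leq_trans ltc).
apply: etrans (meetR P sylP pP _) (esym (meetR Q sylQ pQ _)).
  by rewrite properE sDP subsetI (negPf nsPQ) andbF.
by rewrite properE sDQ subsetI (negPf nsQP).
Qed.

(** Modulo [N], every element of [G] equals its p-part, so [G / N] is a p-group
    and the image of a Sylow p-subgroup is all of it. *)
Lemma mulN_Sylow (P : {group gT}) : p.-Sylow(G) P -> G = N * P :> {set gT}.
Proof.
move=> sylP; have nNG := normal_norm nsNG.
have nNP := subset_trans (pHall_sub sylP) nNG.
have pGq : p.-group (G / N).
  apply: pgroup_elt => _ /morphimP[y Ny Gy ->].
  rewrite -(consttC p y) morphM ?groupX //=.
  rewrite (coset_id (p'elt_inside _ (p_elt_constt _ _))) ?groupX // mulg1.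
  by rewrite morph_p_elt ?groupX // p_elt_constt.
have sylPq : p.-Sylow(G / N) (P / N) by apply: quotient_pHall.
by rewrite -quotientK // (pHall_id sylPq pGq) quotientGK.
Qed.

Lemma frobenius_wielandt_outside (P : {group gT}) :
  p.-Sylow(G) P -> frobenius_wielandt_triple G P (P :&: N)%G.
Proof.
move=> sylP; have [sPG pP _] := and3P sylP.
split=> //; first exact: normalGI sPG nsNG.
move=> g /setDP[Gg P'g]; rewrite subsetI subsetIl /=.
apply/negPn/negP=> N'D; case/negP: P'g.
have sylPg : p.-Sylow(G) (P :^ g) by rewrite pHallJ.
have eqPg : P :=: P :^ g := Sylow_meet_outside sylP sylPg N'D.
have N'P : ~~ (P \subset N).
  by apply: contra N'D; apply: subset_trans; apply: subsetIl.
have pNP := normaliser_outside_pgroup sPG pP N'P.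
have sPN : P \subset 'N_G(P) by rewrite subsetI sPG normG.
rewrite -(sub_pHall sylP pNP sPN (subsetIl _ _)) inE Gg.
by apply/normP; rewrite -eqPg.
Qed.

End OutsidePElements.

(** Unless it is empty, [H :\: N] is a TI-subset of [G] with normaliser [H], so
    its [|G : H|] conjugates are pairwise disjoint subsets of [G :\: N], and the
    two sets have the same size. *)
Lemma frobenius_wielandt_class_support (gT : finGroupType) (G N H : {group gT}) :
    N <| G -> G = N * H :> {set gT} ->
    frobenius_wielandt_triple G H (H :&: N)%G ->
  G :\: N \subset class_support (H :\: N) G.
Proof.
move=> nsNG defG [sHG _ FW]; have nNG := normal_norm nsNG.
have [sHN | nsHN] := boolP (H \subset N).
  suff -> : G :\: N = set0 by apply: sub0set.
  by apply/eqP; rewrite setD_eq0 defG mul_subG.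
have sSGN : class_support (H :\: N) G \subset G :\: N.
  apply/subsetP=> _ /imset2P[x g /setDP[Hx N'x] Gg ->].
  by rewrite inE memJ_norm ?(subsetP nNG) // N'x groupJ // (subsetP sHG).
have TI : normedTI (H :\: N) G H.
  apply/normedTI_P; split; first by rewrite setD_eq0.
    rewrite subsetI sHG; apply/normsP=> h Hh.
    by rewrite conjDg conjGid // (normP (subsetP nNG h (subsetP sHG h Hh))).
  move=> g Gg; apply: contraR => H'g; rewrite -setI_eq0.
  apply/eqP/setP=> x; rewrite conjDg !inE; apply/negP.
  case/andP=> /andP[N'x Hx] /andP[_ Hgx].
  have /FW/subsetP/(_ x) : g \in G :\: H by rewrite inE H'g.
  by rewrite !inE Hx Hgx (negPf N'x); case/(_ _)/andP.
rewrite (_ : G :\: N = class_support (H :\: N) G) //.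
apply/esym/eqP; rewrite eqEcard sSGN (card_support_normedTI TI) /=.
(* After subtracting from [|G : H| |H| = |G|], multiplying by [|H|] turns the
   rest, [|G : H| |H :&: N| <= |N|], into the product formula for [N * H]. *)
rewrite !cardsD (setIidPr (normal_sub nsNG)) mulnBl Lagrange //.
rewrite leq_sub2l // -(@leq_pmul2r #|H|) // -mulnA.
by rewrite [(#|G : H| * _)%N]mulnC Lagrange // mul_cardG -defG setIC mulnC.
Qed.

Theorem theorem1p1 (gT : finGroupType) (G N : {group gT}) (p : nat)
    (p_pr : prime p) (nsNG : N <| G) :
  (forall x : gT, x \in G :\: N -> p.-elt x) <->
  (p.-group G \/
   exists P : {group gT},
     [/\ p.-Sylow(G) P, G = N * P :> {set gT}
       & frobenius_wielandt_triple G P (P :&: N)%G]).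
Proof.
split=> [pGN | [pG x /setDP[Gx _] | [P [sylP defG FW]] x GN'x]].
- right; have [P sylP] := Sylow_exists p G; exists P; split=> //.
    exact: mulN_Sylow pGN _ sylP.
  exact: frobenius_wielandt_outside pGN _ sylP.
- exact: mem_p_elt pG Gx.
have := subsetP (frobenius_wielandt_class_support nsNG defG FW) x GN'x.
case/imset2P=> y g /setDP[Py _] _ ->.
by rewrite p_eltJ; apply: mem_p_elt (pHall_pgroup sylP) Py.
Qed.
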